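(* Let $G$ be a finite group, let $I$ and $\Lambda$ be finite (non-empty) index sets, and let $P=(p_{\lambda i})$ be a regular $\Lambda\times I$ matrix with entries in $G^0$ that contains at least one zero entry. Write $\omega$ for the clique number of $\mathcal{G}(\mathcal{M}_0[G;I,\Lambda;P])$. (1) Suppose that $G$ is abelian. If $D_3$ is a $\leftrightarrow$-submatrix of $\overline{P}$ and $O_{1\times 3}$, $O_{3\times 1}$ and $O_{2\times 2}$ are not $\leftrightarrow$-submatrices of $\overline{P}$, then $\omega=3|G|$. (2) Suppose that $G$ is abelian. If $D_2$ is a $\leftrightarrow$-submatrix of $\overline{P}$ and $O_{1\times 2}$ and $O_{2\times 1}$ are not $\leftrightarrow$-submatrices of $\overline{P}$, then $\omega=2|G|$. (3) In all the remaining cases, $\omega=|G|\cdot\max\{nm: O_{n\times m}\text{ is a }\leftrightarrow\text{-submatrix of }\overline{P}\}$.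
   Context: $G^0=G\cup\{0\}$ is $G$ with a zero adjoined. A matrix over $G^0$ is regular if every row and every column contains a non-zero entry. The $0$-Rees matrix semigroup $\mathcal{M}_0[G;I,\Lambda;P]$ is the set $(I\times G\times\Lambda)\cup\{0\}$ with $(i,x,\lambda)(j,y,\mu)=(i,xp_{\lambda j}y,\mu)$ if $p_{\lambda j}\neq 0$, $(i,x,\lambda)(j,y,\mu)=0$ if $p_{\lambda j}=0$, and all products involving $0$ equal to $0$. The commuting graph $\mathcal{G}(S)$ of a finite non-commutative semigroup $S$ is the simple graph with vertex set $S\setminus Z(S)$ ($Z(S)$ the center), where distinct $x,y$ are adjacent iff $xy=yx$. (When $P$ is regular and has a zero entry, $\mathcal{M}_0[G;I,\Lambda;P]$ is non-commutative with center $\{0\}$.) The clique number is the largest size of a set of pairwise adjacent vertices. $\overline{P}$ is the matrix obtained from $P$ by replacing each non-zero entry by the symbol $\times$. A matrix $Q$ is a $\leftrightarrow$-submatrix of a matrix $M$ if $Q$ can be obtained by permuting the rows and/or columns of a submatrix of $M$. $D_n$ is the $n\times n$ matrix with diagonal entries $\times$ and all other entries $0$. $O_{n\times m}$ ($n,m\ge 1$) is the $n\times m$ matrix all of whose entries are $0$. *)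

(* Defs.v *)
From HB Require Import structures.
From mathcomp Require Import all_boot all_fingroup.

Set Implicit Arguments.
Unset Strict Implicit.
Unset Printing Implicit Defensive.

Definition clique (V : finType) (e : rel V) (K : {set V}) : bool :=
  [forall x in K, forall y in K, (x != y) ==> e x y].

Definition clique_number (V : finType) (e : rel V) : nat :=
  \max_(K : {set V} | clique e K) #|K|.

Section CommutingGraph.

Variables (S : finType) (mul : SemiGroup.law S).

Definition center : {set S} := [set x | [forall y, mul x y == mul y x]].

Definition commuting_graph : rel {x : S | x \notin center} :=
  [rel x y | (x != y) && (mul (val x) (val y) == mul (val y) (val x))].

End CommutingGraph.

Arguments commuting_graph {S} mul.

(* A Lambda x I matrix over G^0 is a function [Lambda -> I -> option G], where
   [None] is the adjoined zero of G^0. *)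
Section Rees.

Variables (G : finGroupType) (I Lambda : finType).
Implicit Type P : Lambda -> I -> option G.

Definition regular P : Prop :=
  (forall l, exists i, P l i <> None) /\ (forall i, exists l, P l i <> None).

Definition rees0 : finType := option (I * G * Lambda).

Definition rees0_mul P (a b : rees0) : rees0 :=
  match a, b return option (I * G * Lambda) with
  | Some (i, x, l), Some (j, y, m) =>
      if P l j is Some p then Some (i, (x * p * y)%g, m) else None
  | _, _ => None
  end.

Lemma rees0_mulA P : associative (rees0_mul P).
Proof.
move=> [[[i x] l]|] [[[j y] m]|] [[[k z] n]|] //=; last by case: (P l j).
by case Emk: (P m k) => [q|]; case Elj: (P l j) => [p|] //=;
  rewrite ?Emk ?Elj ?mulgA.
Qed.

HB.instance Definition _ P :=
  SemiGroup.isLaw.Build rees0 (rees0_mul P) (@rees0_mulA P).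

End Rees.

(* Matrices over the two symbols 0 and [x] are boolean: [true] is the symbol
   [x] and [false] is 0. *)
Definition pattern (G : Type) (I Lambda : Type) (P : Lambda -> I -> option G) :
  Lambda -> I -> bool := fun l i => P l i.

Definition Dmx (n : nat) : 'I_n -> 'I_n -> bool := fun i j => i == j.

Definition Omx (n m : nat) : 'I_n -> 'I_m -> bool := fun _ _ => false.

(* Selecting some rows and columns and then permuting them amounts to an
   injective choice of rows and an injective choice of columns. *)
Definition lr_submatrix (R C R' C' : finType) (T : eqType)
    (Q : R -> C -> T) (M : R' -> C' -> T) : bool :=
  [exists f : {ffun R -> R'}, exists g : {ffun C -> C'},
    [&& injectiveb f, injectiveb g
      & [forall r, forall c, Q r c == M (f r) (g c)]]].

Lemma lr_submatrixP (R C R' C' : finType) (T : eqType)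
    (Q : R -> C -> T) (M : R' -> C' -> T) :
  reflect (exists (f : R -> R') (g : C -> C'),
             [/\ injective f, injective g & forall r c, Q r c = M (f r) (g c)])
          (lr_submatrix Q M).
Proof.
apply: (iffP existsP) => [[f /existsP[g /and3P[/injectiveP fI /injectiveP gI]]]|].
  by move=> /forallP QM; exists f, g; split=> // r c; apply/eqP/(forallP (QM r)).
move=> [f [g [fI gI QM]]]; exists (finfun f); apply/existsP; exists (finfun g).
apply/and3P; split.
- by apply/injectiveP => r1 r2; rewrite !ffunE => /fI.
- by apply/injectiveP => c1 c2; rewrite !ffunE => /gI.
- by apply/forallP => r; apply/forallP => c; rewrite !ffunE QM.
Qed.

(* The bounds on n and m lose nothing, by [max_zero_block_ge]. *)
Definition max_zero_block (R C : finType) (M : R -> C -> bool) : nat :=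
  \max_(n < #|R|.+1) \max_(m < #|C|.+1 |
      [&& 1 <= n, 1 <= m & lr_submatrix (@Omx n m) M]) (n * m).

Section MaxZeroBlock.

Variables (R C : finType) (M : R -> C -> bool).

Lemma max_zero_block_ge n m :
  1 <= n -> 1 <= m -> lr_submatrix (@Omx n m) M -> n * m <= max_zero_block M.
Proof.
move=> n1 m1 OM; have [f [g [fI gI _]]] := lr_submatrixP _ _ OM.
have nR : n < #|R|.+1 by rewrite ltnS -[n]card_ord (leq_card f).
have mC : m < #|C|.+1 by rewrite ltnS -[m]card_ord (leq_card g).
apply: (bigmax_sup (Ordinal nR)) => //.
by apply: (bigmax_sup (Ordinal mC)); rewrite //= n1 m1.
Qed.

Lemma max_zero_block_attained r c : M r c = false ->
  exists n m, [/\ 1 <= n, 1 <= m, lr_submatrix (@Omx n m) M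
                & max_zero_block M = n * m].
Proof.
move=> Mrc; have O1 : lr_submatrix (@Omx 1 1) M.
  apply/lr_submatrixP; exists (fun=> r), (fun=> c).
  by split=> // [x y _|x y _]; rewrite !ord1.
have gt0 : 0 < max_zero_block M by apply: (max_zero_block_ge (n := 1) (m := 1)).
pose ex k := exists n m,
  [/\ 1 <= n, 1 <= m, lr_submatrix (@Omx n m) M & k = n * m].
suff [E|] : max_zero_block M = 0 \/ ex (max_zero_block M) by [rewrite E in gt0|].
have maxK k1 k2 : k1 = 0 \/ ex k1 -> k2 = 0 \/ ex k2 ->
    maxn k1 k2 = 0 \/ ex (maxn k1 k2).
  by move=> H1 H2; case: (leqP k1 k2).
apply: (big_ind (fun k => k = 0 \/ ex k)); [by left | exact: maxK|] => n _.
apply: (big_ind (fun k => k = 0 \/ ex k)); [by left | exact: maxK|] => m.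
by case/and3P=> n1 m1 OM; right; exists n, m.
Qed.

End MaxZeroBlock.

(* Main.v *)
Require Import Defs.
From mathcomp Require Import all_boot all_fingroup.
From mathcomp Require Import zify.

(* Non-zero elements at distinct positions (i, l) and (j, m) commute iff both
   p_lj and p_mi are 0; two elements at the same position always commute when
   p_li = 0, and otherwise only when their right translates by p_li commute in
   G.  Hence a clique is governed by the set T of positions it occupies, each of
   which carries at most |G| elements.  If T meets a zero entry of P, then T
   embeds into a zero block of P; otherwise T is a copy of D_n, which contains
   O_(a x b) whenever a + b <= n, and a(n - a) >= n is possible when n >= 4,
   while n <= 1 is covered by any zero entry, so only n = 2 and n = 3 remain.
   For non-abelian G a non-zero position carries at most |G|/2 elements, which
   settles these two values of n. *)

Set Implicit Arguments.
Unset Strict Implicit.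
Unset Printing Implicit Defensive.

(** * Zero blocks and diagonal submatrices of a pattern *)

Section Submatrices.

Lemma lr_submatrix_trans (R1 C1 R2 C2 R3 C3 : finType) (T : eqType)
    (M1 : R1 -> C1 -> T) (M2 : R2 -> C2 -> T) (M3 : R3 -> C3 -> T) :
  lr_submatrix M1 M2 -> lr_submatrix M2 M3 -> lr_submatrix M1 M3.
Proof.
move=> /lr_submatrixP[f [g [fI gI E]]] /lr_submatrixP[f' [g' [fI' gI' E']]].
apply/lr_submatrixP; exists (f' \o f), (g' \o g).
by split=> [||r c]; [exact: inj_comp | exact: inj_comp | rewrite E E'].
Qed.

Lemma widen_ord_inj n n' (le_n : n <= n') : injective (widen_ord le_n).
Proof. by move=> i j /(congr1 val) /= /val_inj. Qed.

Lemma Omx_sub n m n' m' :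
  n <= n' -> m <= m' -> lr_submatrix (@Omx n m) (@Omx n' m').
Proof.
move=> le_n le_m; apply/lr_submatrixP; exists (widen_ord le_n), (widen_ord le_m).
by split=> //; apply: widen_ord_inj.
Qed.

Lemma Dmx_sub n n' : n <= n' -> lr_submatrix (@Dmx n) (@Dmx n').
Proof.
move=> le_n; apply/lr_submatrixP; exists (widen_ord le_n), (widen_ord le_n).
by split=> //; apply: widen_ord_inj.
Qed.

(** The first [a] rows and the last [b] columns of $D_{a+b}$ miss the diagonal. *)
Lemma Omx_sub_Dmx a b n : a + b <= n -> lr_submatrix (@Omx a b) (@Dmx n).
Proof.
move=> le_n; apply: lr_submatrix_trans (Dmx_sub le_n).
apply/lr_submatrixP; exists (@lshift a b), (@rshift a b).
split; [exact: lshift_inj | exact: rshift_inj | move=> r c].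
by rewrite /Dmx eq_lrshift.
Qed.

Variables (R C : finType) (M : R -> C -> bool).

Lemma zero_block_submatrix (A : {set R}) (B : {set C}) :
  {in A & B, forall r c, M r c = false} -> lr_submatrix (@Omx #|A| #|B|) M.
Proof.
move=> M0; apply/lr_submatrixP; exists (@enum_val _ (mem A)), (@enum_val _ (mem B)).
split; [exact: enum_val_inj | exact: enum_val_inj | move=> r c].
by rewrite M0 ?enum_valP.
Qed.

Lemma leq_max_zero_block (A : {set R}) (B : {set C}) :
  {in A & B, forall r c, M r c = false} -> #|A| * #|B| <= max_zero_block M.
Proof.
move=> M0; have [->//|A0] := posnP #|A|.
have [->|B0] := posnP #|B|; first by rewrite muln0.
by apply: max_zero_block_ge => //; apply: zero_block_submatrix.
Qed.

(** The condition that pairwise commutation forces on a set of occupied positions (column, row); the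
    entries at the positions themselves stay free. *)
Definition cross_free (T : {set C * R}) :=
  {in T &, forall t u, t != u -> M t.2 u.1 = false}.

Lemma cross_free_Dmx (T : {set C * R}) :
  cross_free T -> {in T, forall t, M t.2 t.1} -> lr_submatrix (@Dmx #|T|) M.
Proof.
move=> T0 TM; pose e (k : 'I_#|T|) : C * R := enum_val k.
have eT k : e k \in T by exact: enum_valP.
have De r c : Dmx r c = M (e r).2 (e c).1.
  rewrite /Dmx; case: eqVneq => [->|nrc]; first by rewrite TM.
  by rewrite T0 // (inj_eq enum_val_inj).
(* Positions sharing a row or a column would put a non-zero entry off the diagonal, so both index
   maps are injective. *)
have DI r c : Dmx r c -> r = c by move/eqP.
apply/lr_submatrixP; exists (fun k => (e k).2), (fun k => (e k).1).
split=> // r c E; apply: DI; rewrite De; first by rewrite E -De /Dmx.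
by rewrite -E -De /Dmx.
Qed.

(* A non-zero position (c, r) of T is moved to (c, r0); its column is not the
   column of any other position of T, so this is injective. *)
Lemma cross_free_zero (T : {set C * R}) z :
  cross_free T -> z \in T -> M z.2 z.1 = false -> #|T| <= max_zero_block M.
Proof.
move=> T0 zT Mz; pose A := [set t.2 | t in T & ~~ M t.2 t.1].
pose B := [set t.1 | t in T].
pose f (t : C * R) := (t.1, if M t.2 t.1 then z.2 else t.2).
have zA : z.2 \in A by apply/imsetP; exists z; rewrite // inE zT Mz.
have colI t u : t \in T -> u \in T -> M t.2 t.1 -> t.1 = u.1 -> t = u.
  move=> tT uT Mt Etu; apply: contraTeq Mt => ntu.
  by rewrite Etu T0.
have fI : {in T &, injective f}.
  move=> t u tT uT [E1].
  case Mt: (M t.2 t.1); first by move=> _; apply: colI.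
  case Mu: (M u.2 u.1); first by move=> _; apply/esym/colI.
  by case: t u E1 {tT uT Mt Mu} => [a b] [c d] /= -> ->.
have: #|T| <= #|setX B A|.
  rewrite -(card_in_imset fI); apply/subset_leq_card/subsetP => _ /imsetP[t tT ->].
  rewrite inE /= imset_f //=; case Mt: (M _ _) => //.
  by apply/imsetP; exists t; rewrite // inE tT Mt.
rewrite cardsX mulnC => /leq_trans; apply; apply: leq_max_zero_block.
move=> _ _ /imsetP[t /setIdP[tT /negbTE Mt] ->] /imsetP[u uT ->].
by have [<-//|] := eqVneq t u; apply: T0.
Qed.

End Submatrices.

(** Commuting elements generate an abelian subgroup, which is proper and so has index at least 2. *)
Lemma card_commuting_nonabelian (G : finGroupType) (X : {set G}) :
  ~ abelian [set: G] -> {in X &, commutative (fun x y : G => (x * y)%g)} -> 2 * #|X| <= #|G|.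
Proof.
move=> nabG cX; set H := <<X>>%G.
have abH : abelian H.
  rewrite abelian_gen; apply/centsP => x xX y yX; exact: cX.
have idx : 1 < #|[set: G] : H|%g.
  rewrite indexg_gt1; apply/negP => GH; apply: nabG; exact: abelianS GH abH.
have /leq_mul/(_ idx) := subset_leq_card (subset_gen X).
by rewrite Lagrange ?subsetT // cardsT mulnC.
Qed.

(** * Commuting elements of the Rees semigroup and bounds on the clique number *)

Section Rees.

Variables (G : finGroupType) (I Lambda : finType) (P : Lambda -> I -> option G).

Notation pat := (pattern P).
Notation mul := (rees0_mul P).
Notation omega := (clique_number (commuting_graph (rees0_mul P))).

Definition pos (t : I * G * Lambda) : I * Lambda := (t.1.1, t.2).

Definition commuting_set (A : {set I * G * Lambda}) :=
  {in A &, forall s t, mul (Some s) (Some t) = mul (Some t) (Some s)}.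

Lemma rees0_mul_zero s t : pat s.2 t.1.1 = false -> mul (Some s) (Some t) = None.
Proof. by case: s t => [[i x] l] [[j y] m]; rewrite /pattern /=; case: (P l j). Qed.

(** If one product is non-zero then so is the other, and comparing their outer coordinates makes the
    positions equal. *)
Lemma rees0_comm_zero s t :
  mul (Some s) (Some t) = mul (Some t) (Some s) -> pos s != pos t ->
  pat s.2 t.1.1 = false.
Proof.
case: s t => [[i x] l] [[j y] m]; rewrite /pattern /pos /=.
by case: (P l j) (P m i) => [p|] [q|] //= [-> _ ->]; rewrite eqxx.
Qed.

Hypothesis P_regular : regular P.
Hypothesis P_zero : exists l i, P l i = None.

Lemma rees0_center_zero : None \in center (rees0_mul P).
Proof. by rewrite inE; apply/forallP => -[[[i x] l]|]. Qed.

(** A central triple would force [Lambda] to have a single row; the column of a zero entry would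
    then vanish, against regularity. *)
Lemma rees0_not_central s : Some s \notin center (rees0_mul P).
Proof.
case: s => [[i x] l]; rewrite inE; apply/negP => /forallP cs.
have [j Plj] := P_regular.1 l.
have rowE m : m = l.
  have /eqP := cs (Some (j, 1%g, m)) => /=.
  by case: (P l j) Plj => [p|] //; case: (P m i) => [q|] //= _ [].
have [l0 [i0 P0]] := P_zero; have [m []] := P_regular.2 i0.
by rewrite (rowE m) -(rowE l0).
Qed.

Lemma omega_ge (U : finType) (f : U -> I * G * Lambda) :
  injective f ->
  (forall u v, mul (Some (f u)) (Some (f v)) = mul (Some (f v)) (Some (f u))) ->
  #|U| <= omega.
Proof.
move=> fI cf; pose h u := exist (fun s => s \notin center mul) _ (rees0_not_central (f u)).
have hI : injective h by move=> u v /(congr1 val) /= [/fI].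
rewrite -cardsT -(card_imset _ hI).
apply: (bigmax_sup (h @: [set: U])) => //.
apply/forall_inP => _ /imsetP[u _ ->]; apply/forall_inP => _ /imsetP[v _ ->].
by apply/implyP => nuv; apply/andP; split=> //; apply/eqP; apply: cf.
Qed.

Lemma omega_le n :
  (forall A, commuting_set A -> #|A| <= n) -> omega <= n.
Proof.
move=> An; apply/bigmax_leqP => K /forall_inP cK.
pose A := [set t | Some t \in val @: K].
have -> : #|K| = #|A|.
  rewrite -(card_imset _ val_inj) -(card_imset A Some_inj).
  congr #|pred_of_set _|; apply/setP => -[t|].
    by rewrite mem_imset ?inE //; apply: Some_inj.
  have /negP/negbTE -> : ~ None \in val @: K.
    by case/imsetP => -[s sZ] _ /= sN; rewrite -sN rees0_center_zero in sZ.
  by apply/esym/negP => /imsetP[].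
apply: An => s t; rewrite !inE => /imsetP[u uK Eu] /imsetP[v vK Ev].
rewrite Eu Ev; have [->//|nuv] := eqVneq u v.
by have /forall_inP/(_ v vK) := cK u uK; rewrite nuv /= => /andP[_ /eqP].
Qed.

(** All products of elements positioned in a zero block are 0, whatever their group entries. *)
Lemma omega_ge_Omx n m : lr_submatrix (@Omx n m) pat -> #|G| * (n * m) <= omega.
Proof.
move=> /lr_submatrixP[f [g [fI gI E]]].
pose h (u : G * ('I_n * 'I_m)) := (g u.2.2, u.1, f u.2.1).
have hI : injective h by move=> [x [r c]] [y [s d]] [/gI -> -> /fI ->].
have := @omega_ge _ h hI; rewrite !card_prod !card_ord; apply=> u v.
by rewrite !rees0_mul_zero //= -E.
Qed.

Lemma omega_ge_Dmx n :
  abelian [set: G] -> lr_submatrix (@Dmx n) pat -> n * #|G| <= omega.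
Proof.
move=> /centsP abG /lr_submatrixP[f [g [fI gI E]]].
pose h (u : 'I_n * G) := (g u.1, u.2, f u.1).
have hI : injective h by move=> [r x] [s y] [/gI -> -> _].
have := @omega_ge _ h hI; rewrite !card_prod !card_ord; apply=> -[r x] [s y].
have cG (a b : G) : (a * b = b * a)%g by apply: abG; rewrite inE.
have [<-|nrs] := eqVneq r s.
  by rewrite /h /=; case: (P _ _) => // p; rewrite -mulgA cG [(p * y)%g]cG.
by rewrite !rees0_mul_zero //= -E /Dmx ?(negbTE nrs) // eq_sym (negbTE nrs).
Qed.

Lemma commuting_set_bound (A : {set I * G * Lambda}) : commuting_set A ->
  #|A| <= #|G| * max_zero_block pat \/
  exists n, [/\ lr_submatrix (@Dmx n) pat, #|A| <= #|G| * n
              & ~ abelian [set: G] -> 2 * #|A| <= #|G| * n].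
Proof.
move=> cA; pose T := pos @: A.
(* The group entries occurring in [A] at position [t]. *)
pose F (t : I * Lambda) := [set x | (t.1, x, t.2) \in A].
have cardA : #|A| = \sum_(t in T) #|F t|.
  rewrite -sum1_card (partition_big_imset pos) /=; apply: eq_bigr => t _.
  have FI : injective (fun x : G => (t.1, x, t.2)) by move=> x y [].
  rewrite -(card_imset (F t) FI) -sum1_card; apply: eq_bigl => s.
  apply/andP/imsetP => [[sA /eqP <-]|[x]].
    by exists s.1.2; rewrite ?inE; case: s sA => [[]].
  by rewrite inE => xA ->; split=> //; case: (t).
have leA : #|A| <= #|G| * #|T|.
  by rewrite cardA mulnC -sum_nat_const leq_sum // => t _; rewrite max_card.
have T0 : cross_free pat T.
  move=> _ _ /imsetP[s sA ->] /imsetP[t tA ->].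
  by apply: rees0_comm_zero; apply: cA.
have [/existsP[z /andP[zT Mz]]|/existsPn TM] :=
  boolP [exists z, (z \in T) && ~~ pat z.2 z.1].
  left; apply: leq_trans leA _; rewrite leq_mul2l.
  by rewrite (cross_free_zero T0 zT) ?orbT //; apply/negbTE.
have {}TM t : t \in T -> pat t.2 t.1.
  by move=> tT; have := TM t; rewrite tT negbK.
right; exists #|T|; split=> //; first exact: cross_free_Dmx.
move=> nab; rewrite cardA big_distrr /= mulnC -sum_nat_const leq_sum // => t tT.
have := TM t tT; rewrite /pattern; case Pt: (P t.2 t.1) => [p|] // _.
(* Commuting at this position means $xpy=ypx$, that is, $xp$ and $yp$ commute in $G$. *)
rewrite -(card_imset _ (@mulIg _ p)); apply: card_commuting_nonabelian nab _.
move=> _ _ /imsetP[x + ->] /imsetP[y + ->]; rewrite !inE => xA yA.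
by have := cA _ _ xA yA; rewrite /= Pt => -[E]; rewrite !mulgA E.
Qed.

End Rees.

(** * Comparison of the zero-block and diagonal bounds in the three cases *)

Theorem theorem5p4 (G : finGroupType) (I Lambda : finType)
    (P : Lambda -> I -> option G)
    (I_nonempty : 0 < #|I|) (Lambda_nonempty : 0 < #|Lambda|)
    (P_regular : regular P)
    (P_zero : exists l i, P l i = None) :
  let omega := clique_number (commuting_graph (rees0_mul P)) in
  let case1 :=
    [/\ abelian [set: G],
        lr_submatrix (@Dmx 3) (pattern P),
        ~~ lr_submatrix (@Omx 1 3) (pattern P),
        ~~ lr_submatrix (@Omx 3 1) (pattern P)
      & ~~ lr_submatrix (@Omx 2 2) (pattern P)] in
  let case2 :=
    [/\ abelian [set: G],
        lr_submatrix (@Dmx 2) (pattern P),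
        ~~ lr_submatrix (@Omx 1 2) (pattern P)
      & ~~ lr_submatrix (@Omx 2 1) (pattern P)] in
  [/\ case1 -> omega = 3 * #|G|,
      case2 -> omega = 2 * #|G|
    & ~ case1 -> ~ case2 -> omega = #|G| * max_zero_block (pattern P)].
Proof.
move=> omega case1 case2; set M := pattern P; set k := max_zero_block M.
have [l [i Pli]] := P_zero.
have Mli : M l i = false by rewrite /M /pattern Pli.
have [a [b [a0 b0 Oab kE]]] := max_zero_block_attained Mli.
have Osub c d n m : c <= n -> d <= m ->
    lr_submatrix (@Omx n m) M -> lr_submatrix (@Omx c d) M.
  by move=> cn dm; apply: lr_submatrix_trans; apply: Omx_sub.
have OD c d n : c + d <= n -> lr_submatrix (@Dmx n) M -> lr_submatrix (@Omx c d) M.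
  by move=> cdn; apply: lr_submatrix_trans; apply: Omx_sub_Dmx.
have kge c d : 0 < c -> 0 < d -> lr_submatrix (@Omx c d) M -> c * d <= k.
  exact: max_zero_block_ge.
have noO c d : 0 < c -> 0 < d -> k < c * d -> ~~ lr_submatrix (@Omx c d) M.
  by move=> c0 d0; apply: contraTN => O; rewrite -leqNgt kge.
have upper n : k <= n -> (forall m, lr_submatrix (@Dmx m) M -> m <= n) ->
    omega <= n * #|G|.
  move=> kn Dn; apply: omega_le => A /commuting_set_bound[|[m [Dm + _]]].
    by rewrite mulnC => /leq_trans; apply; rewrite leq_mul2r kn orbT.
  by rewrite mulnC => /leq_trans; apply; rewrite leq_mul2r Dn ?orbT.
split.
- case=> abG D3 O13 O31 O22; apply/eqP; rewrite eqn_leq andbC.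
  rewrite (omega_ge_Dmx P_regular P_zero abG D3) /=; apply: upper => [|m Dm].
    rewrite /k kE; apply: contraT => ab.
    have [b3|b3] := leqP 3 b; first by rewrite (Osub 1 3 a b) in O13.
    have [a3|a3] := leqP 3 a; first by rewrite (Osub 3 1 a b) in O31.
    (* With both sides at most 2, an area above 3 leaves only the 2 by 2 block. *)
    have [a2 b2] : 2 <= a /\ 2 <= b by nia.
    by rewrite (Osub 2 2 a b) in O22.
  by apply: contraNT O22 => m4; apply: (OD 2 2 m); lia.
- case=> abG D2 O12 O21; apply/eqP; rewrite eqn_leq andbC.
  rewrite (omega_ge_Dmx P_regular P_zero abG D2) /=; apply: upper => [|m Dm].
    rewrite /k kE; apply: contraT => ab.
    have [b2|b2] := leqP 2 b; first by rewrite (Osub 1 2 a b) in O12.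
    have [a2|a2] := leqP 2 a; first by rewrite (Osub 2 1 a b) in O21.
    by nia.
  by apply: contraNT O12 => m3; apply: (OD 1 2 m); lia.
move=> ncase1 ncase2; apply/eqP; rewrite eqn_leq andbC -/k.
rewrite {1}/k kE (omega_ge_Omx P_regular P_zero Oab) /=.
have k1 : 1 <= k by rewrite /k kE muln_gt0 a0.
apply: omega_le => A /commuting_set_bound[//|[n [Dn leA leA2]]].
have [kn|nk] := leqP n k; first by apply: leq_trans leA _; rewrite leq_mul2l kn orbT.
(* For $n\ge 4$, $D_n$ contains a zero block of area $2(n-2)\ge n$, so [k] would be at least [n]. *)
have n3 : n <= 3.
  apply: contraTT nk => n4; rewrite -leqNgt.
  have /kge : lr_submatrix (@Omx 2 (n - 2)) M by apply: (OD 2 _ n) => //; lia.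
  by lia.
have k2 : n = 3 -> 2 <= k.
  by move=> n3E; rewrite (kge 1 2) // (OD 1 2 n) // n3E.
have n32 : n = 3 \/ n = 2 by lia.
have [abG|/negP/leA2 {}leA2] := boolP (abelian [set: G]); last first.
  (* Here $k\ge 1$ settles $n=2$ and $k\ge 2$ settles $n=3$; the halved bound on [A] then
     suffices. *)
  have n2k : n <= 2 * k by lia.
  rewrite -(leq_pmul2l (isT : 0 < 2)) (leq_trans leA2) //.
  by rewrite mulnCA leq_mul2l n2k orbT.
(* For abelian $G$, $k<n$ rules out every zero block of area at least [n], which together with $D_n$
   is exactly an excluded case. *)
case: n32 => [n3E|n2E].
- by case: ncase1; rewrite n3E in Dn nk; split=> //; apply: noO => //; lia.
- by case: ncase2; rewrite n2E in Dn nk; split=> //; apply: noO => //; lia.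
Qed.
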